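(* Let $S$ be a Damek--Ricci space with Lie algebra $\mathfrak s=\mathfrak v\oplus\mathfrak z\oplus\mathfrak a$, let $\xi=(v,z,s)\in\mathfrak s\cong T_eS$ be a unit vector, and let $\gamma\colon\mathbb R\mathbf P^1\to\mathbf P(\mathfrak s\oplus\mathbb R)$ be the prolongation of the unit speed geodesic starting from $e$ with initial velocity $\xi$, in the half-space model. Then $\gamma$ is a birational equivalence onto (i) an ellipse in $\mathfrak s$ if $z\neq 0$; (ii) the closure in $\mathbf P(\mathfrak s\oplus\mathbb R)$ of a parabola in $\mathfrak s$ with axis parallel to $\mathfrak a$ if $z=0$ but $v\neq 0$; (iii) the closure in $\mathbf P(\mathfrak s\oplus\mathbb R)$ of a straight line parallel to $\mathfrak a$ if $\xi\in\mathfrak a$.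
   Context: Damek--Ricci space: let $\mathfrak s=\mathfrak v\oplus\mathfrak z\oplus\mathfrak a$ be an orthogonal decomposition of a finite-dimensional Euclidean space $(\mathfrak s,\langle\,,\rangle)$ with $\mathfrak a=\mathbb RA$, $\|A\|=1$, $n=\dim\mathfrak v$, $m=\dim\mathfrak z$ (either may be $0$). Let $J$ be a representation on $\mathfrak v$ of the Clifford algebra $\mathrm{Cl}(\mathfrak z,q)$ of $q(Z)=-\langle Z,Z\rangle$ with $\|J_ZV\|=\|Z\|\|V\|$ for all $Z\in\mathfrak z,V\in\mathfrak v$. For $U,V\in\mathfrak v$ define $[U,V]\in\mathfrak z$ by $\langle[U,V],Z\rangle=\langle J_ZU,V\rangle$ for all $Z\in\mathfrak z$. The Lie bracket on $\mathfrak s$ is $[V+Z+sA,U+X+tA]=(\frac s2U-\frac t2V)+([U,V]_*+sX-tZ)$ with $[U,V]_*$ denoting the $\mathfrak z$-valued bracket $[V,U]$ of the $\mathfrak v$-components $V$ and $U$ in this order. The simply connected Lie group $S$ with Lie algebra $\mathfrak s$ and the left-invariant metric induced by $\langle\,,\rangle$ is the Damek--Ricci space. Half-space model: $S$ is identified with $\mathfrak v\oplus\mathfrak z\times\mathbb R_+$ via $(V,Z,t)\mapsto\exp(V+Z)\exp((\ln t)A)$; the identity is $e=(0,0,1)$. The half-space lies in $\mathfrak v\oplus\mathfrak z\oplus\mathbb R\cong\mathfrak s$ (with $\mathbb R\cong\mathfrak a$), and $(v,z,s)\in T_eS$ means $v+z+sA$. $\mathbf P(\mathfrak s\oplus\mathbb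 R)$ is the projective closure of the affine space $\mathfrak s$. Prolongation: the unit speed geodesic $\hat\gamma$ with $\hat\gamma(0)=e$, $\hat\gamma'(0)=\xi=(v,z,s)$ is $\hat\gamma(t)=\gamma(\tanh(t/2))$, where $$\gamma(\theta)=\left(\frac{2\theta(1-s\theta)}{\chi(\theta)}v+\frac{2\theta^2}{\chi(\theta)}J_zv,\ \frac{2\theta}{\chi(\theta)}z,\ \frac{1-\theta^2}{\chi(\theta)}\right),\qquad \chi(\theta)=(1-s\theta)^2+\|z\|^2\theta^2 .$$ The prolongation of $\hat\gamma$ is the continuous extension $\gamma\colon\mathbb R\mathbf P^1\to\mathbf P(\mathfrak s\oplus\mathbb R)$ of this map. Circles are regarded as ellipses. *)

(* Defs.v *)
From HB Require Import structures.
From mathcomp Require Import all_boot all_order all_algebra sesquilinear ring.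
From mathcomp Require Import all_classical all_reals all_analysis.
(* The notations of mpoly clash with those of mathcomp-analysis. *)
From mathcomp Require Import -(notations) mpoly.

Set Implicit Arguments.
Unset Strict Implicit.
Unset Printing Implicit Defensive.

Import Order.TTheory GRing.Theory Num.Theory.
Import numFieldNormedType.Exports.

Local Open Scope classical_set_scope.
Local Open Scope ring_scope.

Section Projective.
Context {R : realType}.

Definition proj (E : vectType R) : Type := {l : {vspace E} | \dim l == 1%N}.

HB.instance Definition _ (E : vectType R) := Choice.on (proj E).

Definition line_of (E : vectType R) (l : proj E) : {vspace E} := sval l.

Definition of_coords (E : vectType R) (x : 'rV[R]_(\dim {:E})) : E :=
  passmx.vecof (vbasis {:E}) x.

Lemma of_coords_neq0 (E : vectType R) (x : 'rV[R]_(\dim {:E})) :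
  x != 0 -> of_coords x != 0.
Proof. by rewrite passmx.vecof_eq0 // vbasisP. Qed.

(* Quotient topology of the map x |-> <[x]>, defined on E minus the origin,
   where E is identified with R^(dim E) by a basis. *)
Definition proj_cone (E : vectType R) (A : set (proj E)) :
    set 'rV[R]_(\dim {:E}) :=
  [set x | x != 0 /\ exists2 l, A l & of_coords x \in line_of l].

Definition proj_open (E : vectType R) : set_system (proj E) :=
  [set A | open (proj_cone A)].

Lemma vline_dim1 (E : vectType R) (x : E) : x != 0 -> \dim <[x]>%VS == 1%N.
Proof. by move=> x0; rewrite dim_vline x0. Qed.

Definition proj_point (E : vectType R) (x : E) (x0 : x != 0) : proj E :=
  exist _ <[x]>%VS (vline_dim1 x0).

Lemma line_of_inj (E : vectType R) (l l' : proj E) (x : E) :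
  x != 0 -> x \in line_of l -> x \in line_of l' -> l = l'.
Proof.
have H (k : proj E) : x != 0 -> x \in line_of k -> line_of k = <[x]>%VS.
  move=> x0 xk; apply/eqP; rewrite eq_sym eqEdim -memvE xk.
  by rewrite dim_vline x0 (eqP (svalP k)).
move=> x0 xl xl'; apply: val_inj.
exact: etrans (H l x0 xl) (esym (H l' x0 xl')).
Qed.

Lemma proj_openT (E : vectType R) : proj_open (E := E) setT.
Proof.
rewrite /proj_open /=.
have -> : proj_cone (E := E) setT = ~` [set 0].
  apply/seteqP; split=> [x [/eqP x0 _] //|x /eqP x0]; split => //.
  by exists (proj_point (of_coords_neq0 x0)) => //; exact: memv_line.
apply: closed_openC; apply: accessible_closed_set1.
exact/hausdorff_accessible/norm_hausdorff.
Qed.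

Lemma proj_openI (E : vectType R) : setI_closed (proj_open (E := E)).
Proof.
move=> A B oA oB; rewrite /proj_open /=.
suff -> : proj_cone (A `&` B) = proj_cone A `&` proj_cone B by exact: openI.
apply/seteqP; split=> [x [x0 [l [Al Bl] xl]]|x [[x0 [l Al xl]] [_ [l' Bl' xl']]]].
  by split; split=> //; exists l.
split=> //; exists l => //; split=> //.
by rewrite (line_of_inj (of_coords_neq0 x0) xl xl').
Qed.

Lemma proj_open_bigU (E : vectType R) (I : Type) (f : I -> set (proj E)) :
  (forall i, proj_open (f i)) -> proj_open (\bigcup_i f i).
Proof.
move=> of_; rewrite /proj_open /=.
suff -> : proj_cone (\bigcup_i f i) = \bigcup_i proj_cone (f i).
  by apply: bigcup_open => i _; exact: of_.
apply/seteqP; split=> [x [x0 [l [i _ fil] xl]]|x [i _ [x0 [l fil xl]]]].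
  by exists i => //; split=> //; exists l.
by split=> //; exists l => //; exists i.
Qed.

HB.instance Definition _ (E : vectType R) := @isOpenTopological.Build (proj E)
  (@proj_open E) (@proj_openT E) (@proj_openI E) (@proj_open_bigU E).

End Projective.

(* Projective closure P(E (+) R) of the affine space E. *)
Definition proj_closure (R : realType) (E : vectType R) := proj (E * R^o)%type.

Lemma affine_point_subproof (R : realType) (E : vectType R) (x : E) :
  ((x, 1) : (E * R^o)%type) != 0.
Proof. by rewrite xpair_eqE oner_eq0 andbF. Qed.

Definition affine_point (R : realType) (E : vectType R) (x : E) :
  proj_closure E := proj_point (affine_point_subproof x).

Section Birational.
Context {R : realType}.
Implicit Types E F : vectType R.

Definition homogeneous n d (p : mpoly n R) : Prop :=
  p \is ishomog1 d (@mdeg n).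

Definition coord_eval E (p : mpoly (\dim {:E}) R) (x : E) : R :=
  meval (fun i => coord (vbasis {:E}) i x) p.

Definition zariski_closed E (C : set (proj E)) : Prop :=
  exists I : set (mpoly (\dim {:E}) R),
    (forall p, I p -> exists d, homogeneous d p) /\
    C = [set l | forall p x, I p -> x \in line_of l -> coord_eval p x = 0].

Definition zariski_dense_open E (X U : set (proj E)) : Prop :=
  (exists2 C, zariski_closed C & U = X `\` C) /\
  (forall C, zariski_closed C -> U `<=` C -> X `<=` C).

(* f is a rational map on X: on a dense Zariski open subset of X it is given by
   homogeneous polynomials of a common degree, without common zero there. *)
Definition rational_on E F (X : set (proj E)) (f : proj E -> proj F) : Prop :=
  exists (U : set (proj E)) (d : nat)
         (p : 'I_(\dim {:F}) -> mpoly (\dim {:E}) R),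
    [/\ zariski_dense_open X U,
        forall i, homogeneous d (p i) &
        forall l x, U l -> x \in line_of l -> x != 0 ->
          let y : F := of_coords (\row_i coord_eval (p i) x) in
          y != 0 /\ y \in line_of (f l)].

Definition birational_onto E F (X : set (proj E)) (Y : set (proj F))
    (f : proj E -> proj F) : Prop :=
  [/\ f @` X = Y,
      rational_on X f &
      exists g : proj F -> proj E,
        [/\ rational_on Y g,
            exists2 U, zariski_dense_open X U & forall l, U l -> g (f l) = l &
            exists2 W, zariski_dense_open Y W &
              forall m, W m -> X (g m) /\ f (g m) = m]].

End Birational.

Section Conics.
Context {R : realType} {E : vectType R} (dot : {dot E for @idfun R}).

Definition orthonormal_pair (u w : E) : Prop :=
  [/\ dot u u = 1, dot w w = 1 & dot u w = 0].

Definition is_ellipse (C : set E) : Prop :=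
  exists (c u w : E) (a b : R),
    [/\ orthonormal_pair u w, 0 < a, 0 < b &
        C = [set p | exists x y : R, (x / a) ^+ 2 + (y / b) ^+ 2 = 1 /\
                                     p = c + x *: u + y *: w]].

Definition is_parabola_with_axis_parallel_to (D : {vspace E}) (C : set E) :
    Prop :=
  exists (c u w : E) (k : R),
    [/\ orthonormal_pair u w, w \in D, 0 < k &
        C = [set p | exists x y : R, y = k * x ^+ 2 /\
                                     p = c + x *: u + y *: w]].

End Conics.

Definition is_line_parallel_to (R : realType) (E : vectType R) (D : {vspace E})
    (C : set E) : Prop :=
  exists c w : E, [/\ w != 0, w \in D & C = [set c + x *: w | x in [set: R]]].

Record clifford_algebra (R : realType) (Z : vectType R) (q : Z -> R) :=
  CliffordAlgebra {
    cliff_alg :> algType R;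
    cliff_inj : {linear Z -> cliff_alg};
    cliff_rel : forall X, cliff_inj X * cliff_inj X = (q X)%:A;
    cliff_ext : forall (B : algType R) (f : {linear Z -> B}),
      (forall X, f X * f X = (q X)%:A) ->
      exists g : {lrmorphism cliff_alg -> B}, forall X, g (cliff_inj X) = f X;
    cliff_uniq : forall (B : algType R) (g h : {lrmorphism cliff_alg -> B}),
      (forall X, g (cliff_inj X) = h (cliff_inj X)) -> g =1 h }.

Definition dnorm (R : realType) (E : vectType R) (dot : {dot E for @idfun R})
  (x : E) : R := Num.sqrt (dot x x).

(* The data which determine the Lie algebra s = v (+) z (+) a. The endomorphisms
   of [dr_v] are not an [algType] when [dr_v] is trivial, so that the
   representation is a linear map that preserves 1 and products. *)
Record damek_ricci (R : realType) := DamekRicci {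
  dr_v : vectType R;
  dr_z : vectType R;
  dr_dotv : {dot dr_v for @idfun R};
  dr_dotz : {dot dr_z for @idfun R};
  dr_cliff : clifford_algebra (fun Z : dr_z => - dr_dotz Z Z);
  dr_rep : {linear dr_cliff -> 'End(dr_v)};
  dr_rep1 : dr_rep 1 = \1%VF;
  dr_repM : forall a b, dr_rep (a * b) = (dr_rep a \o dr_rep b)%VF;
  dr_norm_rep : forall (Z : dr_z) (V : dr_v),
    dnorm dr_dotv (dr_rep (cliff_inj dr_cliff Z) V) =
    dnorm dr_dotz Z * dnorm dr_dotv V }.

Section DamekRicci.
Context {R : realType} (S : damek_ricci R).

Definition dr_J (Z : dr_z S) : 'End(dr_v S) :=
  dr_rep S (cliff_inj (dr_cliff S) Z).

Definition dr_s : vectType R := (dr_v S * dr_z S * R^o)%type.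

Definition dr_A : dr_s := (0, 0, 1).

Definition dr_a : {vspace dr_s} := <[dr_A]>%VS.

Definition dr_dot (x y : dr_s) : R :=
  dr_dotv S x.1.1 y.1.1 + dr_dotz S x.1.2 y.1.2 + x.2 * y.2.

Let dr_dot_bilinear :
  bilinear_for (GRing.Scale.Law.clone _ _ *%R _)
    (GRing.Scale.Law.clone _ _ (@idfun R \; *%R) _) dr_dot.
Proof.
have scE (b c : R) : b *: (c : R^o) = b * c by [].
split=> [y a x x'|x a y y']; rewrite /dr_dot /=.
  rewrite [in dr_dotv S _ _]linearPl [in dr_dotz S _ _]linearPl /= scE.
  move: (dr_dotv S _ _) (dr_dotv S _ _) (dr_dotz S _ _) (dr_dotz S _ _).
  by move=> *; ring.
rewrite !linearPr /= scE.
move: (dr_dotv S _ _) (dr_dotv S _ _) (dr_dotz S _ _) (dr_dotz S _ _).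
by move=> *; ring.
Qed.

HB.instance Definition _ := bilinear_isBilinear.Build R dr_s dr_s R
  (GRing.Scale.Law.clone _ _ *%R _)
  (GRing.Scale.Law.clone _ _ (@idfun R \; *%R) _) dr_dot dr_dot_bilinear.

Let dr_dot_sym x y : dr_dot x y = (-1) ^+ false * idfun (dr_dot y x).
Proof.
rewrite /dr_dot expr0 mul1r /=; congr (_ + _ + _); last exact: mulrC.
  by rewrite hermitian_subproof expr0 mul1r.
by rewrite hermitian_subproof expr0 mul1r.
Qed.

HB.instance Definition _ :=
  isHermitianSesquilinear.Build R dr_s false (@idfun R) dr_dot dr_dot_sym.

Let dr_dot_gt0 x : x != 0 -> 0 < dr_dot x x.
Proof.
case: x => [[v z] s]; rewrite !xpair_eqE !negb_and /dr_dot /= => x0.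
have ge0 (E : vectType R) (g : {dot E for @idfun R}) u : 0 <= g u u.
  have [->|u0] := eqVneq u 0; first by rewrite linear0l.
  exact: ltW (neq0_dnorm_gt0 _ u0).
case/orP: x0 => [/orP[v0|z0]|s0].
- rewrite -addrA ltr_wpDr ?addr_ge0 ?ge0 ?neq0_dnorm_gt0 //.
  by rewrite -expr2 sqr_ge0.
- rewrite ltr_wpDr -?expr2 ?sqr_ge0 // ltr_wpDl ?ge0 ?neq0_dnorm_gt0 //.
- rewrite ltr_wpDl ?addr_ge0 ?ge0 // -expr2.
  by rewrite lt_neqAle sqr_ge0 eq_sym sqrf_eq0 s0.
Qed.

HB.instance Definition _ := isDotProduct.Build R dr_s dr_dot dr_dot_gt0.

Definition dr_chi (xi : dr_s) (th : R) : R :=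
  (1 - xi.2 * th) ^+ 2 + dr_dotz S xi.1.2 xi.1.2 * th ^+ 2.

(* The unit speed geodesic with initial velocity xi at the identity (0, 0, 1)
   is t |-> dr_curve xi (tanh (t / 2)). *)
Definition dr_curve (xi : dr_s) (th : R) : dr_s :=
  let: (v, z, s) := xi in
  ((2 * th * (1 - s * th) / dr_chi xi th) *: v +
     (2 * th ^+ 2 / dr_chi xi th) *: dr_J z v,
   (2 * th / dr_chi xi th) *: z,
   (1 - th ^+ 2) / dr_chi xi th).

(* RP^1 is [proj_closure R^o]. *)
Definition is_prolongation (xi : dr_s)
    (gamma : proj_closure R^o -> proj_closure dr_s) : Prop :=
  continuous gamma /\
  forall th : R, dr_chi xi th != 0 ->
    gamma (affine_point (th : R^o)) = affine_point (dr_curve xi th).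

End DamekRicci.

(* Main.v *)
Require Import Defs.
From HB Require Import structures.
From mathcomp Require Import all_boot all_order all_algebra sesquilinear ring.
From mathcomp Require Import all_classical all_reals all_analysis.
From mathcomp Require Import -(notations) mpoly.

Set Implicit Arguments.
Unset Strict Implicit.
Unset Printing Implicit Defensive.

(* [proj] of the topology of function spaces would otherwise hide the type of
   points of a projective space. *)
Import Defs.
Import Order.TTheory GRing.Theory Num.Theory.
Import numFieldNormedType.Exports.

(** The curve [gamma] is a rational curve of degree at most two. Write a point
    of the projective line as (th : ta). If (v, z) is not 0, multiplying the
    affine curve by its denominator gives a vector [conic_lift] of quadratic
    forms in (th, ta) without common zero, and hence a map that is defined and
    continuous on the whole projective line ([proj_map_continuous]). If v and z
    both vanish, then s^2 = 1, numerator and denominator share the factor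
    ta - s th, and what remains after cancelling it is the linear map
    [line_lift]. The prolongation is unique because projective spaces are
    Hausdorff ([proj_hausdorff]) and the points where the affine formula applies
    are dense ([prolongation_unique]).

    For birationality, a linear map H that satisfies H (G (th, ta)) = c (th, ta)
    with a scalar c that vanishes only at special points is a rational inverse
    of the map induced by the lift G ([birational_of_linear_inverse]). Such an H
    reads a few coordinates of the lift: up to a constant, for z <> 0 it recovers
    (th^2, th ta), for z = 0 and v <> 0 it recovers X (th, ta) with
    X = ta - s th, and for the line it inverts a linear isomorphism. Zariski
    density of the domains follows from density in the classical topology, since
    Zariski closed sets are closed ([zariski_closed_closed]).

    It remains to recognize the image. The last coordinate of the lift is
    X^2 + |z|^2 th^2. For z <> 0 it is positive, so the curve is affine; with
    (X, |z| th) = (cos phi, sin phi) up to a factor, the affine point is of the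
    form c + cos (2 phi) P + sin (2 phi) Q with P and Q linearly independent,
    and P and Q are conjugate radii of an ellipse whose axes are found by
    diagonalizing their Gram matrix ([is_ellipse_conjugate_radii]). For z = 0
    and t = th / X, the affine point is
    (2 t v, 0, 1 + 2 s t - |v|^2 t^2), which traces a parabola. In this case and
    in that of the line, the affine part of the curve is the image of a dense
    set of parameters, and its closure is the whole image because the projective
    line is compact ([closure_proj_image]). *)

Local Open Scope classical_set_scope.
Local Open Scope ring_scope.

(** * Forms and maps given by forms *)

Section Forms.
Context {R : realType}.
Implicit Types E F : vectType R.

(** Functions given by homogeneous polynomials in the coordinates of the basis
    that [coord_eval] uses. Working with functions lets forms be combined and
    recognized without ever naming a polynomial. *)
Definition is_form E d (phi : E -> R) : Prop :=
  exists2 p : mpoly (\dim {:E}) R, homogeneous d p & coord_eval p =1 phi.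

Lemma form_eq E d (phi psi : E -> R) :
  phi =1 psi -> is_form d phi -> is_form d psi.
Proof. by move=> e [p hp pE]; exists p => // x; rewrite pE. Qed.

Lemma form_cst E (c : R) : is_form 0 (fun _ : E => c).
Proof.
exists (mpolyC _ c) => [|x]; last exact: mevalC.
by rewrite -[mpolyC _ c]mulr1 mul_mpolyC; apply: dhomogZ; exact: dhomog1.
Qed.

Lemma formD E d (phi psi : E -> R) :
  is_form d phi -> is_form d psi -> is_form d (fun x => phi x + psi x).
Proof.
move=> [p hp pE] [q hq qE]; exists (p + q); first exact: dhomogD.
by move=> x; rewrite /coord_eval mevalD [meval _ p]pE [meval _ q]qE.
Qed.

Lemma formM E d e (phi psi : E -> R) :
  is_form d phi -> is_form e psi -> is_form (d + e) (fun x => phi x * psi x).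
Proof.
move=> [p hp pE] [q hq qE]; exists (p * q); first exact: dhomogM.
by move=> x; rewrite /coord_eval mevalM [meval _ p]pE [meval _ q]qE.
Qed.

Lemma formZ E d c (phi : E -> R) :
  is_form d phi -> is_form d (fun x => c * phi x).
Proof. exact: formM (form_cst E c). Qed.

Lemma form_sum E d (I : Type) (r : seq I) (phi : I -> E -> R) :
  (forall i, is_form d (phi i)) -> is_form d (fun x => \sum_(i <- r) phi i x).
Proof.
move=> H; elim: r => [|i r [p hp pE]].
  exists 0; first exact: dhomog0.
  by move=> x; rewrite big_nil /coord_eval meval0.
apply: form_eq (formD (H i) (ex_intro2 _ _ p hp pE)) => x.
by rewrite big_cons.
Qed.

Lemma scalar_coord E (phi : E -> R) : scalar phi ->
  forall x, phi x = \sum_i coord (vbasis {:E}) i x * phi (vbasis {:E})`_i.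
Proof.
move=> Hphi x.
pose L : {scalar E} := HB.pack phi (GRing.isLinear.Build _ _ _ _ phi Hphi).
have e y : phi y = L y by [].
rewrite [in LHS](coord_vbasis (memvf x)) e linear_sum.
by apply: eq_bigr => i _; exact: (linearZ_LR L).
Qed.

Lemma form_scalar E (phi : E -> R) : scalar phi -> is_form 1 phi.
Proof.
move=> Hphi; apply: (form_eq (fun x => esym (scalar_coord Hphi x))).
apply: form_sum => i.
apply: (@form_eq _ _ (fun x => phi (vbasis {:E})`_i * coord (vbasis {:E}) i x)).
  by move=> x; rewrite mulrC.
apply: formZ; exists (mpolyX R (mnm1 i));
  first by rewrite /homogeneous dhomogX; apply/eqP/mdeg1.
by move=> x; rewrite /coord_eval mevalXU.
Qed.

Lemma form_homog E d (phi : E -> R) : is_form d phi ->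
  forall a x, phi (a *: x) = a ^+ d * phi x.
Proof.
move=> [p hp pE] a x; rewrite -!pE /coord_eval !mevalE mulr_sumr.
rewrite big_seq [RHS]big_seq; apply: eq_bigr => m mp.
rewrite mulrCA; congr (_ * _).
have <- : mdeg m = d := elimT (dhomogP _ _ _) hp m mp.
rewrite mdegE expr_sum -big_split /=; apply: eq_bigr => i _.
by rewrite linearZ /= exprMn.
Qed.

Lemma form_continuous E d (phi : E -> R) : is_form d phi ->
  continuous (phi \o @of_coords R E).
Proof.
move=> [p _ pE] x.
have -> : phi \o @of_coords R E =
    (fun x => \sum_(m <- msupp p) mcoeff m p * \prod_i x 0 i ^+ m i).
  apply/funext => y /=; rewrite -pE /coord_eval mevalE; apply: eq_bigr => m _.
  congr (_ * _); apply: eq_bigr => i _.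
  by rewrite /of_coords passmx.coord_vecof // vbasisP.
apply: continuous_big => [|m _ y]; first exact: add_continuous.
apply: continuousM; first exact: cst_continuous.
apply: continuous_big => [|i _ u]; first exact: mul_continuous.
apply: (@continuous_comp _ _ _ (fun M : 'rV[R]_(\dim {:E}) => M 0 i)
  (fun a => a ^+ m i)); first exact: coord_continuous.
exact: exprn_continuous.
Qed.

Definition form_map E F d (G : E -> F) : Prop :=
  forall i, is_form d (fun x => coord (vbasis {:F}) i (G x)).

Lemma form_mapZ E F d (phi : E -> R) (w : F) :
  is_form d phi -> form_map d (fun x => phi x *: w).
Proof.
move=> hphi i; apply: form_eq (formZ (coord (vbasis {:F}) i w) hphi) => x.
by rewrite linearZ /= mulrC.
Qed.

Lemma form_mapD E F d (G H : E -> F) :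
  form_map d G -> form_map d H -> form_map d (fun x => G x + H x).
Proof.
by move=> hG hH i; apply: form_eq (formD (hG i) (hH i)) => x; rewrite linearD.
Qed.

Lemma form_map_eq E F d (G H : E -> F) : G =1 H -> form_map d G -> form_map d H.
Proof. by move=> e hG i; apply: form_eq (hG i) => x; rewrite e. Qed.

Lemma form_map_scalar E F d (G : E -> F) (phi : F -> R) : form_map d G ->
  scalar phi -> is_form d (phi \o G).
Proof.
move=> hG hphi; apply: (form_eq (fun x => esym (scalar_coord hphi (G x)))).
apply: form_sum => i; apply: form_eq (formZ (phi (vbasis {:F})`_i) (hG i)) => x.
by rewrite mulrC.
Qed.

Lemma form_map_homog E F d (G : E -> F) : form_map d G ->
  forall a x, G (a *: x) = a ^+ d *: G x.
Proof.
move=> hG a x; rewrite (coord_vbasis (memvf (G (a *: x)))).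
rewrite (coord_vbasis (memvf (G x))) scaler_sumr.
by apply: eq_bigr => i _; rewrite scalerA (form_homog (hG i)).
Qed.

Definition coords E (x : E) : 'rV[R]_(\dim {:E}) :=
  \row_i coord (vbasis {:E}) i x.

Lemma coordsK E : cancel (@coords E) (@of_coords R E).
Proof.
move=> x; rewrite [RHS](coord_vbasis (memvf x)) /of_coords /passmx.vecof.
by apply: eq_bigr => i _; rewrite mxE.
Qed.

Lemma of_coordsP E a (x y : 'rV[R]_(\dim {:E})) :
  of_coords (a *: x + y) = a *: of_coords x + of_coords y :> E.
Proof. exact: passmx.vecof_linear. Qed.

Lemma of_coords0 E : of_coords 0 = 0 :> E.
Proof.
have := of_coordsP (-1) (0 : 'rV[R]_(\dim {:E})) 0.
by rewrite scaler0 addr0 scaleN1r addNr.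
Qed.

Lemma of_coordsZ E a (x : 'rV[R]_(\dim {:E})) :
  of_coords (a *: x) = a *: of_coords x :> E.
Proof. by rewrite -[a *: x]addr0 of_coordsP of_coords0 addr0. Qed.

Lemma coords_neq0 E (x : E) : x != 0 -> coords x != 0.
Proof. by apply: contraNneq => e; rewrite -(coordsK x) e of_coords0. Qed.

(** The topology of a projective space is defined through coordinates, so
    continuity of [G] is that of this map between spaces of row vectors. *)
Definition coord_map E F (G : E -> F) (x : 'rV[R]_(\dim {:E})) :
    'rV[R]_(\dim {:F}) := coords (G (of_coords x)).

Lemma coord_mapK E F (G : E -> F) x :
  of_coords (coord_map G x) = G (of_coords x).
Proof. exact: coordsK. Qed.

Lemma coord_map_continuous E F d (G : E -> F) : form_map d G ->
  continuous (coord_map G).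
Proof.
move=> hG x.
have -> : coord_map G = fun x =>
    \sum_i coord (vbasis {:F}) i (G (of_coords x)) *: delta_mx 0 i.
  apply/funext => y; rewrite [LHS]row_sum_delta.
  by apply: eq_bigr => i _; rewrite mxE.
apply: continuous_big => [|i _ y]; first exact: add_continuous.
apply: continuousZr_tmp.
exact: form_continuous (hG i) _.
Qed.

End Forms.

(** * The topology of projective spaces *)

Section Proj.
Context {R : realType}.
Implicit Types E F : vectType R.

Lemma line_ofE E (l : proj E) x :
  x != 0 -> x \in line_of l -> line_of l = <[x]>%VS.
Proof.
move=> x0 xl; apply/eqP; rewrite eq_sym eqEdim -memvE xl.
by rewrite dim_vline x0 (eqP (svalP l)).
Qed.

Lemma line_generator E (l : proj E) : exists2 x, x != 0 & x \in line_of l.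
Proof.
exists (vpick (line_of l)); last exact: memv_pick.
by rewrite vpick0 -dimv_eq0 (eqP (svalP l)).
Qed.

Definition nonvanishing E (phi : E -> R) : set (proj E) :=
  [set l | forall x, x \in line_of l -> x != 0 -> phi x != 0].

Definition positive_locus E (phi : E -> R) : set (proj E) :=
  [set l | forall x, x \in line_of l -> x != 0 -> 0 < phi x].

Lemma nonvanishingP E d (phi : E -> R) l x : is_form d phi ->
  x \in line_of l -> x != 0 -> nonvanishing phi l <-> phi x != 0.
Proof.
move=> hphi xl x0; split => [h|h y]; first exact: h.
rewrite (line_ofE x0 xl) => /vlineP[a ->].
rewrite scaler_eq0 negb_or => /andP[a0 _].
by rewrite (form_homog hphi) mulf_neq0 // expf_neq0.
Qed.

(** The degree is even, so that the sign of the form does not depend on the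
    representative of the point. *)
Lemma positiveP E d (phi : E -> R) l x : is_form (d + d) phi ->
  x \in line_of l -> x != 0 -> positive_locus phi l <-> 0 < phi x.
Proof.
move=> hphi xl x0; split => [h|h y]; first exact: h.
rewrite (line_ofE x0 xl) => /vlineP[a ->].
rewrite scaler_eq0 negb_or => /andP[a0 _].
rewrite (form_homog hphi) mulr_gt0 // exprD -expr2 lt_neqAle sqr_ge0.
by rewrite eq_sym expf_neq0 // expf_neq0.
Qed.

Lemma open_neq0 n : open [set x : 'rV[R]_n | x != 0].
Proof.
have -> : [set x : 'rV[R]_n | x != 0] = ~` [set 0].
  by apply/seteqP; split => x /eqP.
apply: closed_openC; apply: accessible_closed_set1.
exact/hausdorff_accessible/norm_hausdorff.
Qed.

Lemma open_positive E d (phi : E -> R) :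
  is_form (d + d) phi -> open (positive_locus phi).
Proof.
move=> hphi.
have -> : open (positive_locus phi) =
  open (proj_cone (positive_locus phi)) by [].
have -> : proj_cone (positive_locus phi) = [set x | x != 0] `&`
    ((phi \o @of_coords R E) @^-1` [set a | 0 < a]).
  apply/seteqP; split => [x [x0 [l lpos xl]]|x [x0 xpos]].
    by split => //; exact: (lpos _ xl (of_coords_neq0 x0)).
  split => //; exists (proj_point (of_coords_neq0 x0)); last exact: memv_line.
  apply/(positiveP hphi _ (of_coords_neq0 x0)) => //; exact: memv_line.
apply: openI; first exact: open_neq0.
apply: open_comp; last exact: open_gt.
by move=> x _; exact: (form_continuous hphi).
Qed.

Lemma open_nonvanishing E d (phi : E -> R) :
  is_form d phi -> open (nonvanishing phi).
Proof.
move=> hphi.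
suff -> : nonvanishing phi = positive_locus (fun x => phi x * phi x).
  exact: open_positive (formM hphi hphi).
apply/seteqP; split => l h x xl x0; have := h x xl x0.
  by move=> p0; rewrite -expr2 exprn_even_gt0.
by apply: contraTneq => ->; rewrite mul0r ltxx.
Qed.

(** Two distinct points are spanned by independent vectors, which are dual to
    two linear forms; the sign of the difference of the squares of these forms
    separates the points. *)
Lemma proj_hausdorff E : hausdorff_space (proj E).
Proof.
rewrite open_hausdorff => l m lm.
have [x x0 xl] := line_generator l; have [y y0 ym] := line_generator m.
have fxy : free [:: x; y].
  rewrite free_cons seq1_free y0 andbT span_seq1.
  apply: contra lm => /vlineP[a xay]; apply/eqP/(line_of_inj x0 xl).
  by rewrite xay memvZ.
pose X := [tuple x; y].
have fX : free X by [].
pose c i := coord X i : E -> R.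
have sc i : scalar (c i) by move=> a u w; rewrite /c linearP.
have [Ex0 Ex1] : c ord0 x = 1 /\ c (lift ord0 ord0) x = 0.
  by split; rewrite /c (coord_free ord0 _ fX).
have [Ey0 Ey1] : c ord0 y = 0 /\ c (lift ord0 ord0) y = 1.
  by split; rewrite /c (coord_free (lift ord0 ord0) _ fX).
pose q := fun u => c ord0 u * c ord0 u +
  -1 * (c (lift ord0 ord0) u * c (lift ord0 ord0) u).
have hq : is_form (1 + 1) q.
  apply: formD; first by apply: formM; exact: form_scalar.
  by apply: formZ; apply: formM; exact: form_scalar.
have hq' : is_form (1 + 1) (fun u => -1 * q u) by exact: formZ.
exists (positive_locus q, positive_locus (fun u => -1 * q u)).
  split; apply/mem_set.
    apply/(positiveP hq xl x0).
    by rewrite /q Ex0 Ex1 !mulr0 addr0 mulr1.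
  apply/(positiveP hq' ym y0).
  by rewrite /q Ey0 Ey1 !mulr0 add0r !mulr1 mulN1r opprK.
split; [exact: open_positive hq|exact: open_positive hq'|].
apply/eqP/seteqP; split => // k [/= h1 h2].
have [u u0 uk] := line_generator k.
have := h1 _ uk u0; have := h2 _ uk u0.
by rewrite mulN1r oppr_gt0 => /lt_trans /[apply]; rewrite ltxx.
Qed.

(** The projective space is the image of a sphere. *)
Lemma proj_compact E : compact [set: proj E].
Proof.
have [/eqP ->|/set0P [l0 _]] := boolP ([set: proj E] == set0).
  exact: compact0.
pose pi (x : 'rV[R]_(\dim {:E})) : proj E :=
  if pselect (x != 0) is left x0 then proj_point (of_coords_neq0 x0) else l0.
have piE x (x0 : x != 0) : pi x = proj_point (of_coords_neq0 x0).
  rewrite /pi; case: pselect => // h.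
  by congr proj_point; exact: bool_irrelevance.
have pic x : x != 0 -> {for x, continuous pi}.
  move=> x0 A; rewrite nbhsE => -[B [oB Bx] BA].
  have : nbhs x (proj_cone B).
    apply: open_nbhs_nbhs; split => //; split => //.
    by exists (pi x) => //; rewrite (piE _ x0) /=; exact: memv_line.
  apply: filterS => y [y0 [l Bl yl]] /=; apply: BA.
  suff -> : pi y = l by [].
  rewrite (piE _ y0); apply: (line_of_inj (of_coords_neq0 y0)) yl.
  exact: memv_line.
pose Sph := [set x : 'rV[R]_(\dim {:E}) | `|x| = 1].
have Sph0 x : Sph x -> x != 0.
  by move=> /eqP; apply: contraTneq => ->; rewrite normr0 eq_sym oner_eq0.
have cS : compact Sph.
  apply: bounded_closed_compact.
    exists 1; split; first exact: num_real.
    by move=> M M1 x /= ->; exact: ltW.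
  have -> : Sph = (fun x : 'rV[R]_(\dim {:E}) => `|x|) @^-1` [set 1] by [].
  apply: preimage_closed; last exact: closed_eq.
  by move=> x _; exact: norm_continuous.
suff <- : pi @` Sph = [set: proj E].
  apply: continuous_compact => //; apply: continuous_in_subspaceT => x.
  by rewrite inE => /Sph0; exact: pic.
apply/seteqP; split => // l _.
have [x x0 xl] := line_generator l.
pose y := coords x; have y0 : y != 0 by exact: coords_neq0.
have ny : `|y| != 0 by rewrite normr_eq0.
have ny0 : `|y|^-1 *: y != 0 by rewrite scaler_eq0 negb_or invr_eq0 ny.
exists (`|y|^-1 *: y).
  by rewrite /Sph /= normrZ normfV normr_id mulVf.
rewrite (piE _ ny0); apply: (line_of_inj (of_coords_neq0 ny0)).
  exact: memv_line.
by rewrite of_coordsZ memvZ // coordsK.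
Qed.

(** A zero x of [phi] is the limit of the points x + t w as t tends to 0, and
    [phi (x + t w)] is a nonzero multiple of t. *)
Lemma dense_nonvanishing E (phi : E -> R) (w : E) : scalar phi -> phi w != 0 ->
  dense (nonvanishing phi).
Proof.
move=> sphi w0 A [l Al] oA.
have [x x0 xl] := line_generator l.
have hphi := form_scalar sphi.
have [phx|phx] := eqVneq (phi x) 0; last first.
  by exists l; split => //; apply/(nonvanishingP hphi xl x0).
have cx0 := coords_neq0 x0.
have : nbhs (coords x) (proj_cone A).
  apply: open_nbhs_nbhs; split => //; split => //.
  by exists l => //; rewrite coordsK.
have : (fun t : R => coords x + t *: coords w) @ 0^' --> coords x.
  apply: cvg_within_filter.
  have {2}-> : coords x = coords x + 0 *: coords w by rewrite scale0r addr0.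
  apply: cvgD; first exact: cvg_cst.
  by apply: cvgZr_tmp; exact: cvg_id.
move=> /[apply] /= nA.
have [t [[_ [m Am tm]] t0]] : exists t : R,
    proj_cone A (coords x + t *: coords w) /\ t != 0.
  apply: (@filter_ex _ (0 : R)^'); near=> t.
  by split; near: t => //; exact: nbhs_dnbhs_neq.
have e : of_coords (coords x + t *: coords w) = x + t *: w.
  by rewrite addrC of_coordsP !coordsK addrC.
rewrite e in tm.
have pt : phi (x + t *: w) != 0.
  by rewrite addrC sphi phx addr0 mulf_neq0.
have p0 : phi 0 = 0.
  by have := sphi (-1) 0 0; rewrite scaler0 addr0 mulN1r addNr.
exists m; split => //; apply/(nonvanishingP hphi tm) => //.
by apply: contraNneq pt => ->; rewrite p0.
Unshelve. all: by end_near. Qed.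

Lemma dense_agree (T U : topologicalType) (D : set T) (f g : T -> U) :
  hausdorff_space U -> dense D -> continuous f -> continuous g ->
  (forall x, D x -> f x = g x) -> f = g.
Proof.
move=> hU dD cf cg fg; apply/funext => x; apply/eqP/negPn/negP => fgx.
move: hU; rewrite open_hausdorff => /(_ _ _ fgx) [[A B] /= [fA gB] [oA oB AB]].
have [||y [[Ay By] Dy]] := dD (f @^-1` A `&` g @^-1` B).
- by exists x; split; [move: fA|move: gB]; rewrite inE.
- by apply: openI; [move/continuousP: cf; exact|move/continuousP: cg; exact].
by move/eqP/seteqP: AB => [AB _]; apply: (AB (f y)); split => //; rewrite fg.
Qed.

Lemma image_closure_dense (T U : topologicalType) (D : set T) (f : T -> U) :
  dense D -> continuous f -> f @` [set: T] `<=` closure (f @` D).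
Proof.
move=> dD cf _ [x _ <-] A; rewrite nbhsE => -[B [oB Bx] BA].
have [||y [By Dy]] := dD (f @^-1` B); first by exists x.
  by move/continuousP: cf; exact.
by exists (f y); split; [exists y|exact: BA].
Qed.

(** The full image is compact, hence closed, and contains the image of the dense
    set densely. *)
Lemma closure_proj_image E F (D : set (proj E)) (f : proj E -> proj F) :
  dense D -> continuous f -> closure (f @` D) = f @` [set: proj E].
Proof.
move=> dD cf; apply/seteqP; split; last exact: image_closure_dense.
have cl : closed (f @` [set: proj E]).
  apply: compact_closed; first exact: proj_hausdorff.
  by apply: continuous_compact (@proj_compact _); exact: continuous_subspaceT.
rewrite [X in _ `<=` X](closure_id _).1 //; apply: closureS.
by move=> _ [l _ <-]; exists l.
Qed.

(** * Rational and birational maps *)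

(** A total function, as [rational_on] requires; [m0] is a junk value at the
    points where [G] vanishes. *)
Definition proj_map E F (m0 : proj F) (G : E -> F) (l : proj E) : proj F :=
  if pselect (G (vpick (line_of l)) != 0) is left G0 then proj_point G0 else m0.

Lemma mem_proj_map E F d (m0 : proj F) (G : E -> F) l x :
  form_map d G -> x \in line_of l -> G x != 0 ->
  G x \in line_of (proj_map m0 G l).
Proof.
move=> hG xl Gx0.
have [y0 yl] : vpick (line_of l) != 0 /\ vpick (line_of l) \in line_of l.
  by rewrite memv_pick vpick0 -dimv_eq0 (eqP (svalP l)).
move: xl Gx0; rewrite (line_ofE y0 yl) => /vlineP[a ->].
rewrite (form_map_homog hG) scaler_eq0 negb_or => /andP[_ G0].
by rewrite memvZ // /proj_map; case: pselect => // h; exact: memv_line.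
Qed.

Lemma proj_map_continuous E F d (m0 : proj F) (G : E -> F) :
  form_map d G -> (forall x, x != 0 -> G x != 0) ->
  continuous (proj_map m0 G).
Proof.
move=> hG G0; apply/continuousP => A oA.
have -> : open (proj_map m0 G @^-1` A) =
  open (proj_cone (proj_map m0 G @^-1` A)) by [].
have -> : proj_cone (proj_map m0 G @^-1` A) =
   [set x | x != 0] `&` (coord_map G @^-1` proj_cone A).
  apply/seteqP; split => [x [x0 [l Al xl]]|x [x0 [_ [m Am xm]]]].
    split => //; have c0 := G0 _ (of_coords_neq0 x0); split.
      exact: coords_neq0.
    exists (proj_map m0 G l) => //.
    by rewrite coord_mapK; exact: mem_proj_map hG _ _.
  split => //; exists (proj_point (of_coords_neq0 x0)); last exact: memv_line.
  rewrite coord_mapK in xm; rewrite /preimage /=.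
  have c0 := G0 _ (of_coords_neq0 x0).
  suff -> : proj_map m0 G (proj_point (of_coords_neq0 x0)) = m by [].
  apply: (line_of_inj c0) xm; apply: mem_proj_map hG _ c0.
  exact: memv_line.
apply: openI; first exact: open_neq0.
apply: open_comp; last exact: oA.
by move=> x _; exact: (coord_map_continuous hG).
Qed.

Lemma zariski_closed_vanishing E d (phi : E -> R) :
  is_form d phi -> zariski_closed (~` nonvanishing phi).
Proof.
move=> hphi; have [p hp pE] := hphi; exists [set p]; split.
  by move=> _ ->; exists d.
apply/seteqP; split => [l nl _ x -> xl|l h nl].
  rewrite pE; have [y y0 yl] := line_generator l.
  have : phi y = 0.
    apply/eqP; apply: contra_notT nl => ?.
    exact/(nonvanishingP hphi yl).
  move: xl; rewrite (line_ofE y0 yl) => /vlineP[a ->].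
  by rewrite (form_homog hphi) => ->; rewrite mulr0.
have [y y0 yl] := line_generator l.
by have := nl _ yl y0; rewrite -pE (h p) ?eqxx.
Qed.

Lemma zariski_closed_closed E (C : set (proj E)) : zariski_closed C -> closed C.
Proof.
move=> [I [hI ->]]; rewrite -openC.
have -> : ~` [set l | forall p x, I p -> x \in line_of l ->
                       coord_eval p x = 0] =
   \bigcup_(p in I) nonvanishing (coord_eval p).
  apply/seteqP; split => [l|l [p Ip lp] h].
    move=> /existsNP[p /existsNP[x /not_implyP[Ip /not_implyP[xl /eqP px]]]].
    have [d hp] := hI _ Ip; have hpp : is_form d (coord_eval p) by exists p.
    exists p => // y yl y0; move: xl px.
    rewrite (line_ofE y0 yl) => /vlineP[a ->].
    by rewrite (form_homog hpp) mulf_eq0 negb_or => /andP[].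
  have [y y0 yl] := line_generator l.
  by have := lp _ yl y0; rewrite (h p) ?eqxx.
apply: bigcup_open => p /hI[d hp]; apply: (@open_nonvanishing _ d).
by exists p.
Qed.

(** Density in the classical topology suffices, since every Zariski closed set
    is closed. *)
Lemma zariski_dense_open_nonvanishing E d (X : set (proj E)) (phi : E -> R) :
  is_form d phi -> X `<=` closure (X `&` nonvanishing phi) ->
  zariski_dense_open X (X `&` nonvanishing phi).
Proof.
move=> hphi Xcl; split.
  exists (~` nonvanishing phi); last by rewrite setDE setCK.
  exact: zariski_closed_vanishing hphi.
move=> C /zariski_closed_closed cC UC; apply: (subset_trans Xcl).
by rewrite (closure_id C).1 //; exact: closureS.
Qed.

Lemma rational_on_proj_map E F d (X U : set (proj E)) (m0 : proj F)
    (G : E -> F) :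
  form_map d G -> zariski_dense_open X U ->
  (forall l x, U l -> x \in line_of l -> x != 0 -> G x != 0) ->
  rational_on X (proj_map m0 G).
Proof.
move=> hG dU G0; have /choice[p hp] : forall i, exists p : mpoly (\dim {:E}) R,
    homogeneous d p /\ coord_eval p =1 (fun x => coord (vbasis {:F}) i (G x)).
  by move=> i; have [p ? ?] := hG i; exists p.
exists U, d, p; split => // [i|l x Ul xl x0]; first by have [] := hp i.
have -> : (\row_i coord_eval (p i) x) = coords (G x).
  by apply/rowP => i; rewrite !mxE; have [_ ->] := hp i.
rewrite /= coordsK; have Gx0 := G0 _ _ Ul xl x0.
by split => //; exact: mem_proj_map hG _ _.
Qed.

(** The scalar [nu] cuts out the open sets on which the two maps are mutually
    inverse. On the source it is pulled back along [G], so that the two open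
    sets correspond to each other under the induced map, and density in the
    image follows from density in the source by continuity. *)
Lemma birational_of_linear_inverse E F d (l0 : proj E) (m0 : proj F)
    (G : E -> F) (H : F -> E) (nu : F -> R) :
  form_map d G -> (forall x, x != 0 -> G x != 0) ->
  form_map 1 H -> scalar nu -> dense (nonvanishing (nu \o G)) ->
  (forall x, nu (G x) != 0 -> exists2 c, c != 0 & H (G x) = c *: x) ->
  birational_onto [set: proj E] (proj_map m0 G @` [set: proj E])
    (proj_map m0 G).
Proof.
move=> hG G0 hH snu dU HG.
set f := proj_map m0 G; set Y := f @` _.
have cf : continuous f by exact: proj_map_continuous hG G0.
have hnu := form_scalar snu.
have hnuG := form_map_scalar hG snu.
pose U := [set: proj E] `&` nonvanishing (nu \o G).
pose W := Y `&` nonvanishing nu.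
have UW l : U l <-> W (f l).
  have [x x0 xl] := line_generator l.
  have mG := mem_proj_map m0 hG xl (G0 _ x0).
  rewrite /U /W /=; split => -[_].
    move=> /(nonvanishingP hnuG xl x0)/(nonvanishingP hnu mG (G0 _ x0)).
    by split => //; exists l.
  by move=> /(nonvanishingP hnu mG (G0 _ x0))/(nonvanishingP hnuG xl x0).
have dU' : zariski_dense_open [set: proj E] U.
  apply: zariski_dense_open_nonvanishing hnuG _.
  rewrite setTI => l _ A; rewrite nbhsE => -[B [oB Bl] BA].
  have [|y [By yn]] := dU B _ oB; first by exists l.
  by exists y; split => //; exact: BA.
have dW : zariski_dense_open Y W.
  apply: zariski_dense_open_nonvanishing hnu _.
  apply: (subset_trans (image_closure_dense dU cf)).
  by apply: closureS => _ [l Ul <-]; apply/UW.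
pose g := proj_map l0 H.
have gf l : U l -> g (f l) = l.
  move=> Ul; have [x x0 xl] := line_generator l.
  have mG := mem_proj_map m0 hG xl (G0 _ x0).
  have [c c0 HGx] := HG x (Ul.2 _ xl x0).
  have HG0 : H (G x) != 0 by rewrite HGx scaler_eq0 negb_or c0.
  apply: (line_of_inj HG0); first exact: mem_proj_map hH mG HG0.
  by rewrite HGx memvZ.
split=> //.
  by apply: rational_on_proj_map hG dU' _ => l x _ _; exact: G0.
exists g; split; last first.
- exists W => // m Wm; have [[l _ fl] _] := Wm; split => //; subst m.
  by rewrite gf //; apply/UW.
- by exists U.
apply: (rational_on_proj_map _ hH dW) => m y Wm ym y0.
have [[l _ fl] _] := Wm; rewrite -fl in Wm; have Ul := (UW l).2 Wm.
have [x x0 xl] := line_generator l.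
have mG := mem_proj_map m0 hG xl (G0 _ x0).
have [c c0 HGx] := HG x (Ul.2 _ xl x0).
move: ym y0; rewrite -fl (line_ofE (G0 _ x0) mG) => /vlineP[a ->].
rewrite (form_map_homog hH) HGx !scaler_eq0 !negb_or c0 x0 andbT => /andP[a0 _].
by rewrite expf_neq0.
Qed.

End Proj.

(** * Ellipses given by conjugate radii *)

Section Ellipse.
Context {R : realType} {E : vectType R} (dot : {dot E for @idfun R}).

Lemma comb2_comp (P Q : E) (x y a b c d : R) :
  x *: (a *: P + b *: Q) + y *: (c *: P + d *: Q) =
  (x * a + y * c) *: P + (x * b + y * d) *: Q.
Proof. by rewrite !scalerDr !scalerA addrACA -!scalerDl. Qed.

Lemma dot_comb2 (P Q : E) (a b c d : R) :
  dot (a *: P + b *: Q) (c *: P + d *: Q) =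
  a * c * dot P P + (a * d + b * c) * dot P Q + b * d * dot Q Q.
Proof.
have scE (x y : R) : x *: (y : R^o) = x * y by [].
rewrite linearPl /= linearZl_LR /= !linearPr /= !linearZr_LR /=.
have -> : dot Q P = dot P Q.
  by rewrite hermitian_subproof expr0 mul1r.
by rewrite !scE; move: (dot P P) (dot P Q) (dot Q Q) => A B C; ring.
Qed.

(** If A, B, C are the entries of a symmetric matrix, (k, h) is a unit
    eigenvector. *)
Lemma diagonalizing_rotation (A B C : R) :
  exists k h : R, k ^+ 2 + h ^+ 2 = 1 /\
    (C - A) * (k * h) + B * (k ^+ 2 - h ^+ 2) = 0.
Proof.
have [B0|B0] := eqVneq B 0.
  by exists 1, 0; split; rewrite ?B0; ring.
(* D + r and B are, up to a factor, the coordinates of an eigenvector: D and - D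
   are the diagonal entries of the trace free part, r is its eigenvalue. *)
pose D := (A - C) / 2; pose r := Num.sqrt (D ^+ 2 + B ^+ 2).
have r2 : r ^+ 2 = D ^+ 2 + B ^+ 2 by rewrite sqr_sqrtr // addr_ge0 ?sqr_ge0.
pose n2 := (D + r) ^+ 2 + B ^+ 2.
have n20 : 0 < n2 by rewrite ltr_wpDl ?sqr_ge0 // exprn_even_gt0.
pose n := Num.sqrt n2.
have n0 : n != 0 by rewrite gt_eqF // sqrtr_gt0.
have nn : n ^+ 2 = n2 by rewrite sqr_sqrtr // ltW.
exists ((D + r) / n), (B / n); split.
  by rewrite !expr_div_n -mulrDl nn -/n2 divff // gt_eqF.
have -> : C - A = - (2 * D) by rewrite /D; field.
have -> : - (2 * D) * ((D + r) / n * (B / n)) +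
    B * (((D + r) / n) ^+ 2 - (B / n) ^+ 2) =
    B * (r ^+ 2 - D ^+ 2 - B ^+ 2) / n ^+ 2 by field.
by rewrite r2; field.
Qed.

(** A rotation of the parameter circle replaces P and Q by orthogonal vectors
    without changing the curve. *)
Lemma is_ellipse_conjugate_radii (c P Q : E) :
  (forall a b : R, a *: P + b *: Q = 0 -> a = 0 /\ b = 0) ->
  is_ellipse dot [set p | exists x y : R, x ^+ 2 + y ^+ 2 = 1 /\
                                          p = c + x *: P + y *: Q].
Proof.
move=> indep.
have [k [h [kh rot]]] := diagonalizing_rotation (dot P P) (dot P Q) (dot Q Q).
pose P' := k *: P + h *: Q; pose Q' := (- h) *: P + k *: Q.
have P'0 : P' != 0.
  apply/eqP => /indep[k0 h0]; move: kh; rewrite k0 h0 expr0n addr0 => /eqP.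
  by rewrite eq_sym oner_eq0.
have Q'0 : Q' != 0.
  apply/eqP => /indep[/eqP]; rewrite oppr_eq0 => /eqP h0 k0.
  by move: kh; rewrite k0 h0 expr0n addr0 => /eqP; rewrite eq_sym oner_eq0.
have PQ' : dot P' Q' = 0.
  rewrite dot_comb2 -[RHS]rot.
  move: (dot P P) (dot P Q) (dot Q Q) => A B C; ring.
pose a := Num.sqrt (dot P' P'); pose b := Num.sqrt (dot Q' Q').
have gtP : 0 < dot P' P' := neq0_dnorm_gt0 _ P'0.
have gtQ : 0 < dot Q' Q' := neq0_dnorm_gt0 _ Q'0.
have a0 : a != 0 by rewrite gt_eqF // sqrtr_gt0.
have b0 : b != 0 by rewrite gt_eqF // sqrtr_gt0.
have a2 : a ^+ 2 = dot P' P' by rewrite sqr_sqrtr // ltW.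
have b2 : b ^+ 2 = dot Q' Q' by rewrite sqr_sqrtr // ltW.
exists c, (a^-1 *: P'), (b^-1 *: Q'), a, b; split.
- split.
  + by rewrite linearZl_LR linearZr_LR /= -a2; field.
  + by rewrite linearZl_LR linearZr_LR /= -b2; field.
  + by rewrite linearZl_LR linearZr_LR /= PQ' !mulr0.
- by rewrite sqrtr_gt0.
- by rewrite sqrtr_gt0.
have key x y : x *: P + y *: Q =
    (a * (x * k + y * h)) *: (a^-1 *: P') +
    (b * (y * k - x * h)) *: (b^-1 *: Q').
  rewrite !scalerA comb2_comp; congr (_ *: _ + _ *: _).
    have -> : a * (x * k + y * h) / a * k + b * (y * k - x * h) / b * - h =
       x * (k ^+ 2 + h ^+ 2) by field; rewrite a0 b0.
    by rewrite kh mulr1.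
  have -> : a * (x * k + y * h) / a * h + b * (y * k - x * h) / b * k =
       y * (k ^+ 2 + h ^+ 2) by field; rewrite a0 b0.
  by rewrite kh mulr1.
apply/seteqP; split => p [x [y [xy ->]]].
  exists (a * (x * k + y * h)), (b * (y * k - x * h)); split.
    have -> : (a * (x * k + y * h) / a) ^+ 2 + (b * (y * k - x * h) / b) ^+ 2 =
      (x ^+ 2 + y ^+ 2) * (k ^+ 2 + h ^+ 2) by field; rewrite a0 b0.
    by rewrite xy kh mulr1.
  by rewrite -!addrA; congr (_ + _); exact: key.
exists (x / a * k - y / b * h), (x / a * h + y / b * k); split.
  rewrite -[RHS](mulr1 1) -{1}xy -kh; field; rewrite a0 b0 //.
rewrite -!addrA key; congr (_ + (_ *: _ + _ *: _)).
  have -> : a * ((x / a * k - y / b * h) * k + (x / a * h + y / b * k) * h) =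
   x * (k ^+ 2 + h ^+ 2) by field; rewrite a0 b0.
  by rewrite kh mulr1.
have -> : b * ((x / a * h + y / b * k) * k - (x / a * k - y / b * h) * h) =
   y * (k ^+ 2 + h ^+ 2) by field; rewrite a0 b0.
by rewrite kh mulr1.
Qed.

End Ellipse.

Lemma double_angle (R : realType) (x y : R) : x ^+ 2 + y ^+ 2 = 1 ->
  exists X Y, [/\ X ^+ 2 + Y ^+ 2 != 0,
    (X ^+ 2 + Y ^+ 2) * x = X ^+ 2 - Y ^+ 2 &
    (X ^+ 2 + Y ^+ 2) * y = 2 * X * Y].
Proof.
move=> xy; have y2 : y ^+ 2 = 1 - x ^+ 2 by rewrite -xy; ring.
(* (1 + x, y) bisects the angle of (1, 0) and (x, y) unless it vanishes. *)
have [x1|x1] := eqVneq x (-1).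
  have y0 : y = 0 by apply/eqP; rewrite -sqrf_eq0 y2 x1; apply/eqP; ring.
  exists 0, 1; rewrite x1 y0; split; [|ring|ring].
  by rewrite expr0n add0r expr1n oner_neq0.
have x10 : 1 + x != 0 by rewrite addrC addr_eq0.
exists (1 + x), y; have -> : (1 + x) ^+ 2 + y ^+ 2 = 2 * (1 + x).
  by rewrite y2; ring.
split; first by rewrite mulf_neq0 // pnatr_eq0.
  by rewrite y2; ring.
by ring.
Qed.

(** * The affine part of a curve, and lines in the projective line *)

Section AffinePart.
Context {R : realType}.
Implicit Types E F : vectType R.

(** The last coordinate of a lift is the denominator of the affine curve. *)
Lemma proj_map_affine E F d (m0 : proj_closure F) (G : E -> (F * R^o)%type)
    (C : set F) :
  form_map d G ->
  (forall x, x != 0 -> (G x).2 != 0 -> C ((G x).2^-1 *: (G x).1)) ->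
  (forall p, C p -> exists x,
     [/\ x != 0, (G x).2 != 0 & (G x).1 = (G x).2 *: p]) ->
  (@affine_point R F) @` C = proj_map m0 G @` nonvanishing (fun x => (G x).2).
Proof.
move=> hG GC CG.
have sc : scalar (fun y : (F * R^o)%type => y.2 : R) by [].
have h2 := form_map_scalar hG sc.
apply/seteqP; split => [_ [p Cp <-]|_ [l nl <-]].
  have [x [x0 G0 Gp]] := CG p Cp.
  have xl : x \in line_of (proj_point x0) by exact: memv_line.
  exists (proj_point x0); first by apply/(nonvanishingP h2 xl x0).
  have GG : G x = (G x).2 *: ((p, 1) : (F * R^o)%type).
    rewrite [LHS]surjective_pairing Gp; congr pair.
    by rewrite /= -[RHS]/(_ * _) mulr1.
  have Gn : G x != 0 by rewrite GG scaler_eq0 negb_or G0 affine_point_subproof.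
  apply: (line_of_inj Gn); first exact: mem_proj_map hG xl Gn.
  by rewrite GG memvZ // memv_line.
have [x x0 xl] := line_generator l.
have G0 := nl _ xl x0.
exists ((G x).2^-1 *: (G x).1); first exact: GC.
have GG : G x = (G x).2 *: (((G x).2^-1 *: (G x).1, 1) : (F * R^o)%type).
  rewrite [LHS]surjective_pairing; congr pair.
    by rewrite /= scalerA divff // scale1r.
  by rewrite /= -[RHS]/(_ * _) mulr1.
have Gn : G x != 0 by rewrite GG scaler_eq0 negb_or G0 affine_point_subproof.
apply: (line_of_inj Gn); last exact: mem_proj_map hG xl Gn.
by rewrite {1}GG memvZ // memv_line.
Qed.

End AffinePart.

Section RP1.
Context {R : realType}.
Local Notation L := (R^o * R^o)%type.

Lemma scalar_line (a b : R) : scalar (fun x : L => a * x.1 + b * x.2).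
Proof.
move=> k x y /=; have scE (c e : R) : c *: (e : R^o) = c * e by [].
by rewrite !scE; move: x.1 x.2 y.1 y.2 => x1 x2 y1 y2; ring.
Qed.

Lemma form_map_quadratic (F : vectType R) (G : L -> F) (A B C : F) :
  (forall x, G x = ((x.1 : R) * x.1) *: A + ((x.1 : R) * x.2) *: B +
     ((x.2 : R) * x.2) *: C) -> form_map 2 G.
Proof.
move=> GE; apply: (form_map_eq (fun x => esym (GE x))).
have f1 : is_form 1 (fun x : L => x.1 : R) by apply: form_scalar.
have f2 : is_form 1 (fun x : L => x.2 : R) by apply: form_scalar.
by do !apply: form_mapD; apply: form_mapZ; exact: (@formM _ _ 1 1).
Qed.

Lemma dense_nonvanishing_line (a b : R) : a != 0 \/ b != 0 ->
  dense (nonvanishing (fun x : L => a * x.1 + b * x.2 : R)).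
Proof.
case=> h.
  apply: (dense_nonvanishing (w := ((1, 0) : L)) (scalar_line a b)).
  by rewrite /= mulr1 mulr0 addr0.
apply: (dense_nonvanishing (w := ((0, 1) : L)) (scalar_line a b)).
by rewrite /= mulr1 mulr0 add0r.
Qed.

End RP1.

(** * The prolongation *)

Lemma scR (R : realType) (a b : R) : a *: (b : R^o) = a * b.
Proof. by []. Qed.

Lemma dot_ge0 (R : realType) (E : vectType R) (g : {dot E for @idfun R}) u :
  0 <= g u u.
Proof.
have [->|u0] := eqVneq u 0; first by rewrite linear0l.
exact: ltW (neq0_dnorm_gt0 _ u0).
Qed.

Section Geodesic.
Context {R : realType} (S : damek_ricci R) (v : dr_v S) (z : dr_z S) (s : R).
Local Notation L := (R^o * R^o)%type.
Local Notation P1 := (proj_closure R^o).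
Local Notation T := (dr_s S * R^o)%type.
Local Notation xi := ((v, z, s) : dr_s S).
Local Notation r := (dr_dotz S z z : R).
Local Notation w := (dr_J z v).

(** The affine formula applies at all points but (1 : 0) and the zero of
    ta - s th, since [dr_chi] is at least (1 - s th)^2. *)
Lemma prolongation_unique (g h : P1 -> proj_closure (dr_s S)) :
  is_prolongation xi g -> is_prolongation xi h -> g = h.
Proof.
move=> [cg eg] [ch eh].
pose lam a b := fun x : L => a * x.1 + b * x.2 : R.
pose D := nonvanishing (lam 0 1) `&` nonvanishing (lam (- s) 1).
have h1 : is_form 1 (lam 0 1) := form_scalar (scalar_line 0 1).
have h2 : is_form 1 (lam (- s) 1) := form_scalar (scalar_line (- s) 1).
have dD : dense D.
  apply: denseI; first exact: open_nonvanishing h1.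
    by apply: dense_nonvanishing_line; right; rewrite oner_neq0.
  by apply: dense_nonvanishing_line; right; rewrite oner_neq0.
apply: (dense_agree (@proj_hausdorff _ _) dD cg ch) => l [D1 D2].
have [x x0 xl] := line_generator l.
have b0 : x.2 != 0 by have := D1 x xl x0; rewrite /lam mul0r add0r mul1r.
pose th := x.1 / x.2 : R.
pose y : L := (th, 1).
have yl : y \in line_of l.
  suff -> : y = x.2^-1 *: x by rewrite memvZ.
  rewrite [RHS]surjective_pairing; congr pair; rewrite /= scR.
    by rewrite mulrC.
  by rewrite mulVf.
have y0 : y != 0 by exact: affine_point_subproof.
have chi0 : dr_chi xi th != 0.
  have := D2 _ yl y0; rewrite /lam /= mulr1 => n0.
  rewrite gt_eqF // /dr_chi /= ltr_pwDl //.
    by rewrite exprn_even_gt0 //= addrC -mulNr.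
  by rewrite mulr_ge0 ?dot_ge0 // sqr_ge0.
have -> : l = affine_point (th : R^o).
  by apply: (line_of_inj y0) yl _; exact: memv_line.
by rewrite eg // eh.
Qed.

Lemma is_prolongation_proj_map d (m0 : proj_closure (dr_s S)) (G : L -> T) :
  form_map d G -> (forall x, x != 0 -> G x != 0) ->
  (forall th : R, dr_chi xi th != 0 -> exists c,
     G (th, 1) = c *: ((dr_curve xi th, 1) : T)) ->
  is_prolongation xi (proj_map m0 G).
Proof.
move=> hG G0 Gc; split; first exact: proj_map_continuous hG G0.
move=> th /Gc [c GE]; have y0 := affine_point_subproof (th : R^o).
have Gn := G0 _ y0; apply: (line_of_inj Gn).
  by apply: mem_proj_map hG _ Gn; exact: memv_line.
by rewrite GE memvZ // memv_line.
Qed.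

(** The numerators and the denominator of [dr_curve], made homogeneous by
    th := th / ta. *)
Definition conic_lift (x : L) : T :=
  let th := x.1 : R in let ta := x.2 : R in
  (((2 * th * (ta - s * th)) *: v + (2 * th ^+ 2) *: w,
    (2 * th * ta) *: z, ta ^+ 2 - th ^+ 2),
   (ta - s * th) ^+ 2 + r * th ^+ 2).

Lemma conic_lift_quadratic : form_map 2 conic_lift.
Proof.
pose A : T := (((- (2 * s)) *: v + 2 *: w, 0, -1), s ^+ 2 + r).
pose B : T := ((2 *: v, 2 *: z, 0), - (2 * s)).
pose C : T := ((0, 0, 1), 1).
apply: (form_map_quadratic (A := A) (B := B) (C := C)) => -[th ta].
rewrite /conic_lift /=.
have -> (a b c : R) : a *: A + b *: B + c *: C =
  ((a *: A.1.1.1 + b *: B.1.1.1 + c *: C.1.1.1,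
   a *: A.1.1.2 + b *: B.1.1.2 + c *: C.1.1.2,
   a * A.1.2 + b * B.1.2 + c * C.1.2), a * A.2 + b * B.2 + c * C.2) by [].
rewrite /=; congr (_, _, _, _).
- rewrite scaler0 addr0 scalerDr !scalerA addrAC -scalerDl.
  congr (_ *: _ + _ *: _); ring.
- rewrite !scaler0 addr0 add0r scalerA; congr (_ *: _); ring.
- ring.
- ring.
Qed.

Lemma conic_lift_curve th : dr_chi xi th != 0 ->
  conic_lift (th, 1) = dr_chi xi th *: ((dr_curve xi th, 1) : T).
Proof.
move=> c0; rewrite /conic_lift /=.
have -> (c : R) (A : dr_v S) (B : dr_z S) (a b : R) :
  c *: ((A, B, a, b) : T) = (c *: A, c *: B, c * a, c * b) by [].
rewrite scalerDr !scalerA; congr (_ *: _ + _ *: _, _ *: _, _, _);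
  by (field || (rewrite /dr_chi /=; ring)).
Qed.

(** * The ellipse *)

Lemma conic_lift_neq0_z : z != 0 -> forall x, x != 0 -> (conic_lift x).2 != 0.
Proof.
move=> z0 [th ta] x0; rewrite /conic_lift /=.
have r0 : 0 < r := neq0_dnorm_gt0 _ z0.
have [th0|th0] := eqVneq th 0.
  rewrite th0 in x0 *.
  rewrite expr0n /= !mulr0 subr0 addr0 sqrf_eq0.
  by apply: contraNneq x0 => ->.
by rewrite gt_eqF // ltr_wpDl ?sqr_ge0 // mulr_gt0 // exprn_even_gt0.
Qed.

Lemma geodesic_ellipse (m0 : proj_closure (dr_s S)) : z != 0 ->
  exists2 C : set (dr_s S), is_ellipse (dr_dot (S := S)) C &
    birational_onto [set: P1] ((@affine_point R (dr_s S)) @` C)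
      (proj_map m0 conic_lift).
Proof.
move=> z0; have r0 : 0 < r := neq0_dnorm_gt0 _ z0.
pose rho := Num.sqrt r.
have rho2 : rho ^+ 2 = r by rewrite sqr_sqrtr // ltW.
have rho0 : rho != 0 by rewrite gt_eqF // sqrtr_gt0.
(* With X = ta - s th and Y = |z| th, these are the coefficients of 1,
   (X^2 - Y^2) / (X^2 + Y^2) and 2 X Y / (X^2 + Y^2) in the affine curve. *)
pose c : dr_s S := (rho ^- 2 *: w, (s / rho ^+ 2) *: z,
  1 / 2 - (1 - s ^+ 2) / (2 * rho ^+ 2)).
pose P : dr_s S := ((- rho ^- 2) *: w, (- (s / rho ^+ 2)) *: z,
  1 / 2 + (1 - s ^+ 2) / (2 * rho ^+ 2)).
pose Q : dr_s S := (rho^-1 *: v, rho^-1 *: z, s / rho).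
have combE (x y : R) (A B C : dr_s S) : A + x *: B + y *: C =
  (A.1.1 + x *: B.1.1 + y *: C.1.1, A.1.2 + x *: B.1.2 + y *: C.1.2,
   A.2 + x * B.2 + y * C.2) by [].
have lift (X Y x y k : R) : k = X ^+ 2 + Y ^+ 2 ->
    k * x = X ^+ 2 - Y ^+ 2 -> k * y = 2 * X * Y ->
    conic_lift (Y / rho, X + s * (Y / rho)) =
      (k *: (c + x *: P + y *: Q), k).
  move=> kE kx ky; rewrite combE /conic_lift -rho2 /=.
  have -> (A : dr_v S) (B : dr_z S) (a : R) :
     k *: ((A, B, a) : dr_s S) = (k *: A, k *: B, k * a) by [].
  congr (_, _, _, _).
  - rewrite !scalerDr !scalerA -scalerDl addrC; congr (_ *: _ + _ *: _).
      have -> : k * (rho ^- 2) + k * x * - rho ^- 2 =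
        (k - k * x) * rho ^- 2 by field.
      by rewrite kx kE; field.
    by rewrite ky; field.
  - rewrite !scalerA -!scalerDl scalerA; congr (_ *: _).
    have -> : k * (s / rho ^+ 2 + x * - (s / rho ^+ 2) + y * rho^-1) =
      (k - k * x) * (s / rho ^+ 2) + k * y / rho by field.
    by rewrite kx ky kE; field.
  - have -> : k * (1 / 2 - (1 - s ^+ 2) / (2 * rho ^+ 2) +
        x * (1 / 2 + (1 - s ^+ 2) / (2 * rho ^+ 2)) + y * (s / rho)) =
       (k + k * x) / 2 - (k - k * x) * (1 - s ^+ 2) / (2 * rho ^+ 2)
       + k * y * s / rho by field.
    by rewrite kx ky kE; field.
  - by rewrite kE; field.
set C := [set p | exists x y : R,
  x ^+ 2 + y ^+ 2 = 1 /\ p = c + x *: P + y *: Q].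
exists C.
  apply: is_ellipse_conjugate_radii => a b /eqP.
  have -> : a *: P + b *: Q = (a *: P.1.1 + b *: Q.1.1, a *: P.1.2 + b *: Q.1.2,
    a * P.2 + b * Q.2) by [].
  rewrite !xpair_eqE /= => /andP[/andP[_]].
  rewrite !scalerA -scalerDl scaler_eq0 (negbTE z0) orbF => /eqP ez /eqP ea.
  have eb : b = a * s / rho.
    have -> : b = (a * - (s / rho ^+ 2) + b / rho) * rho + a * s / rho by field.
    by rewrite ez mul0r add0r.
  have a0 : a = 0.
    have : a * (rho ^+ 2 + 1 + s ^+ 2) = 0.
      rewrite -[RHS](mul0r (2 * rho ^+ 2)) -ea eb; field.
      by [].
    move/eqP; rewrite mulf_eq0 => /orP[/eqP //|].
    by rewrite gt_eqF // -addrA ltr_wpDl ?sqr_ge0 // ltr_pwDl ?sqr_ge0.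
  by rewrite eb a0 !mul0r.
have hq := conic_lift_quadratic.
have n0 := conic_lift_neq0_z z0.
have N0 x : x != 0 -> conic_lift x != 0.
  by move=> /n0; apply: contraNneq => ->.
have -> : (@affine_point R (dr_s S)) @` C = proj_map m0 conic_lift @` [set: P1].
  have -> : [set: P1] = nonvanishing (fun x : L => (conic_lift x).2).
    by apply/seteqP; split => // l _ x _; exact: n0.
  apply: proj_map_affine hq _ _.
    move=> [th ta] x0 k0; pose X := ta - s * th; pose Y := rho * th.
    have kE : (conic_lift (th, ta)).2 = X ^+ 2 + Y ^+ 2.
      by rewrite /conic_lift /= -rho2 /X /Y exprMn.
    set k := (conic_lift (th, ta)).2 in k0 kE *.
    exists ((X ^+ 2 - Y ^+ 2) / k), (2 * X * Y / k); split.
      have -> : ((X ^+ 2 - Y ^+ 2) / k) ^+ 2 + (2 * X * Y / k) ^+ 2 =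
        (X ^+ 2 + Y ^+ 2) ^+ 2 / k ^+ 2 by field.
      by rewrite -kE divff // expf_neq0.
    have -> : (th, ta) = (Y / rho, X + s * (Y / rho)).
      by rewrite /X /Y; congr pair; field.
    rewrite (lift _ _ ((X ^+ 2 - Y ^+ 2) / k) (2 * X * Y / k) k) //.
    - by rewrite /= scalerA mulVf // scale1r.
    - by field.
    - by field.
  move=> p [x [y [xy ->]]].
  have [X [Y [k0 kx ky]]] := double_angle xy.
  exists (Y / rho, X + s * (Y / rho)).
  rewrite (lift _ _ _ _ _ erefl kx ky); split => //.
  apply: contraNneq k0 => -[/eqP].
  rewrite mulf_eq0 invr_eq0 (negbTE rho0) orbF => /eqP ->.
  by rewrite mul0r mulr0 addr0 => ->; rewrite expr0n addr0.
(* On the lift, the linear forms B and K take the values th ta and q th^2: the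
   component along z is 2 th ta z, and the last coordinate minus the component
   along A is q th^2 - 2 s th ta. *)
pose q := rho ^+ 2 + 1 + s ^+ 2.
have q0 : q != 0.
  by rewrite gt_eqF // /q -addrA ltr_wpDl ?sqr_ge0 // ltr_pwDl ?sqr_ge0.
pose B (y : T) : R := dr_dotz S y.1.1.2 z / (2 * rho ^+ 2).
pose K (y : T) : R := y.2 - y.1.2 + 2 * s * B y.
have sB : scalar B.
  move=> a x y; rewrite /B /= linearPl /= ?scR.
  by move: (dr_dotz S _ _) (dr_dotz S _ _) => ? ?; field.
have sK : scalar K.
  move=> a x y; rewrite /K sB /= !scR.
  by move: (B x) (B y) x.2 y.2 x.1.2 y.1.2 => ? ? ? ? ? ?; ring.
have BE th ta : B (conic_lift (th, ta)) = th * ta.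
  rewrite /B /= linearZl_LR /= ?scR -rho2; field; exact: rho0.
have KE th ta : K (conic_lift (th, ta)) = q * th ^+ 2.
  by rewrite /K BE /= -rho2 /q; ring.
pose H (y : T) : L := (K y, q * B y).
apply: (@birational_of_linear_inverse _ _ _ 2 (affine_point (0 : R^o)) m0 _
  H K) => //.
- apply: (form_map_eq
    (G := fun y => K y *: ((1, 0) : L) + (q * B y) *: ((0, 1) : L))).
    move=> y; rewrite /H; congr pair;
    by rewrite /= !scR ?mulr1 ?mulr0 ?addr0 ?add0r.
  apply: form_mapD; apply: form_mapZ; first exact: form_scalar.
  by apply: formZ; exact: form_scalar.
- have -> : nonvanishing (K \o conic_lift) =
      nonvanishing (fun x : L => 1 * x.1 + 0 * x.2 : R).
    apply/seteqP; split => l h [th ta] xl x0; have := h _ xl x0;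
    by rewrite /= KE mul1r mul0r addr0 mulf_eq0 (negbTE q0) sqrf_eq0.
  by apply: dense_nonvanishing_line; left; rewrite oner_neq0.
- move=> [th ta]; rewrite KE mulf_eq0 (negbTE q0) sqrf_eq0 => th0.
  exists (q * th); first by rewrite mulf_neq0.
  rewrite /H KE BE; congr pair; rewrite /= scR; ring.
Qed.

End Geodesic.

(** * The parabola *)

Section Parabola.
Context {R : realType} (S : damek_ricci R) (v : dr_v S) (s : R).
Local Notation L := (R^o * R^o)%type.
Local Notation P1 := (proj_closure R^o).
Local Notation T := (dr_s S * R^o)%type.
Local Notation q := (dr_dotv S v v : R).

Lemma conic_lift_z0 th ta : conic_lift v 0 s (th, ta) =
  ((2 * th * (ta - s * th)) *: v, 0, ta ^+ 2 - th ^+ 2, (ta - s * th) ^+ 2).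
Proof.
rewrite /conic_lift /dr_J !linear0 lfunE /= mul0r addr0.
by rewrite !scaler0 addr0.
Qed.

Lemma conic_lift_neq0_v : v != 0 -> q = 1 - s ^+ 2 ->
  forall x, x != 0 -> conic_lift v 0 s x != 0.
Proof.
move=> v0 qs [th ta]; rewrite conic_lift_z0 => x0.
have q0 : 0 < q := neq0_dnorm_gt0 _ v0.
apply: contraNneq x0 => -[_]; rewrite -/(_ * _) => e1 /eqP.
rewrite sqrf_eq0 subr_eq0 => /eqP ets.
have : q * th ^+ 2 = 0 by rewrite qs -[RHS]oppr0 -e1 ets; ring.
move/eqP; rewrite mulf_eq0 (gt_eqF q0) sqrf_eq0 => /eqP th0.
by rewrite ets th0 mulr0.
Qed.

Lemma geodesic_parabola (m0 : proj_closure (dr_s S)) :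
  v != 0 -> q = 1 - s ^+ 2 ->
  exists2 C : set (dr_s S),
    is_parabola_with_axis_parallel_to (dr_dot (S := S)) (dr_a S) C &
    birational_onto [set: P1] (closure ((@affine_point R (dr_s S)) @` C))
      (proj_map m0 (conic_lift v 0 s)).
Proof.
move=> v0 qs; have q0 : 0 < q := neq0_dnorm_gt0 _ v0.
pose n := Num.sqrt q.
have n2 : n ^+ 2 = q by rewrite sqr_sqrtr // ltW.
have n2s : n ^+ 2 = 1 - s ^+ 2 by rewrite n2.
have n0 : n != 0 by rewrite gt_eqF // sqrtr_gt0.
(* Completing the square in 1 + 2 s t - n^2 t^2 gives the vertex, at
   t = s / n^2. *)
pose c : dr_s S := ((2 * s / n ^+ 2) *: v, 0, n ^- 2).
pose u : dr_s S := (n^-1 *: v, 0, 0).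
pose w : dr_s S := (0, 0, -1).
set C := [set p | exists x y : R,
  y = 1 / 4 * x ^+ 2 /\ p = c + x *: u + y *: w].
exists C.
  exists c, u, w, (1 / 4); split => //.
    have scE (a b : R) : a *: (b : R^o) = a * b by [].
    have dotE (x y : dr_s S) (k : R) :
      dr_dotv S x.1.1 y.1.1 + dr_dotz S x.1.2 y.1.2 + x.2 * y.2 = k ->
      dr_dot x y = k by [].
    split; apply: dotE; rewrite /= ?linear0l ?linear0r.
    - by rewrite linearZl_LR linearZr_LR /= ?scE -n2 !addr0; field.
    - by rewrite !add0r mulrNN mulr1.
    - by rewrite !addr0.
  apply/vlineP; exists (-1); rewrite /w /dr_A.
  by congr (_, _, _); rewrite ?scaler0 // -[RHS]/(_ * _) mulr1.
have hG := conic_lift_quadratic v 0 s.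
have G0 := conic_lift_neq0_v v0 qs.
have dN : dense (nonvanishing (fun x => (conic_lift v 0 s x).2)).
  have -> : nonvanishing (fun x => (conic_lift v 0 s x).2) =
      nonvanishing (fun x : L => (- s) * x.1 + 1 * x.2 : R).
    apply/seteqP; split => l h [th ta] xl x0; have := h _ xl x0;
    by rewrite conic_lift_z0 /= sqrf_eq0 mul1r mulNr addrC.
  by apply: dense_nonvanishing_line; right; rewrite oner_neq0.
rewrite (proj_map_affine m0 hG (C := C)); last first.
(* The parameter with t = th / X and X = ta - s th = 1. *)
- move=> p [x [y [-> ->]]]; pose t := (x + 2 * s / n) / (2 * n).
  exists (t, 1 + s * t); rewrite conic_lift_z0 /=.
  have -> : 1 + s * t - s * t = 1 by ring.
  rewrite expr1n oner_neq0 scale1r; split => //.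
    apply/eqP => -[t0 /eqP]; rewrite t0 mulr0 addr0.
    by rewrite oner_eq0.
  have -> (k : R) : c + x *: u + k *: w =
    (c.1.1 + x *: u.1.1 + k *: w.1.1, c.1.2 + x *: u.1.2 + k *: w.1.2,
     c.2 + x * u.2 + k * w.2) by [].
  rewrite /= !scaler0 !addr0 scalerA -scalerDl; congr (_ *: _, _, _).
    by rewrite /t; field.
  have -> : (1 + s * t) ^+ 2 - t ^+ 2 = 1 + 2 * s * t - (1 - s ^+ 2) * t ^+ 2.
    by ring.
  have -> : n ^- 2 = (n ^+ 2 + s ^+ 2) / n ^+ 2 by rewrite n2s subrK mul1r.
  by rewrite -n2s /t; field.
- move=> [th ta] x0; rewrite conic_lift_z0 /= sqrf_eq0 => X0.
  set X := ta - s * th in X0 *; pose t := th / X.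
  pose x := 2 * t * n - 2 * s / n.
  exists x, (1 / 4 * x ^+ 2); split => //.
  have -> (k : R) : c + x *: u + k *: w =
    (c.1.1 + x *: u.1.1 + k *: w.1.1, c.1.2 + x *: u.1.2 + k *: w.1.2,
     c.2 + x * u.2 + k * w.2) by [].
  have -> (k : R) (a : dr_v S) (b : dr_z S) (d : R) :
    k *: ((a, b, d) : dr_s S) = (k *: a, k *: b, k * d) by [].
  rewrite /= !scaler0 !addr0 !scalerA -scalerDl; congr (_ *: _, _, _).
    by rewrite /x /t; field; rewrite n0.
  have -> : ta = X + s * th by rewrite /X; ring.
  have -> : X ^- 2 * ((X + s * th) ^+ 2 - th ^+ 2) =
      1 + 2 * s * t - (1 - s ^+ 2) * t ^+ 2 by rewrite /t; field.
  have -> : n ^- 2 = (n ^+ 2 + s ^+ 2) / n ^+ 2 by rewrite n2s subrK mul1r.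
  by rewrite -n2s /x; field.
rewrite closure_proj_image //; last exact: proj_map_continuous hG G0.
(* On the lift, B and K take the values th X and X^2. *)
pose B (y : T) : R := dr_dotv S y.1.1.1 v / (2 * n ^+ 2).
pose K (y : T) : R := y.2.
have sB : scalar B.
  move=> a x y; rewrite /B /= linearPl /=.
  by move: (dr_dotv S _ _) (dr_dotv S _ _) => ? ?; field.
have sK : scalar K by [].
have BE th ta : B (conic_lift v 0 s (th, ta)) = th * (ta - s * th).
  rewrite conic_lift_z0 /B /= linearZl_LR /= -?[_ *: _]/(_ * _) -n2.
  by field; exact: n0.
have KE th ta : K (conic_lift v 0 s (th, ta)) = (ta - s * th) ^+ 2.
  by rewrite conic_lift_z0.
pose H (y : T) : L := (B y, K y + s * B y).
apply: (@birational_of_linear_inverse _ _ _ 2 (affine_point (0 : R^o)) m0 _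
  H K) => //.
- apply: (form_map_eq (G := fun y =>
    B y *: ((1, 0) : L) + (K y + s * B y) *: ((0, 1) : L))).
    move=> y; rewrite /H; congr pair;
    by rewrite /= !scR ?mulr1 ?mulr0 ?addr0 ?add0r.
  apply: form_mapD; apply: form_mapZ; first exact: form_scalar.
  by apply: formD; [|apply: formZ]; exact: form_scalar.
- move=> [th ta]; rewrite KE sqrf_eq0 => X0.
  exists (ta - s * th) => //.
  rewrite /H KE BE; congr pair; rewrite /= scR; ring.
Qed.

End Parabola.

(** * The line *)

Section Line.
Context {R : realType} (S : damek_ricci R) (s : R).
Local Notation L := (R^o * R^o)%type.
Local Notation P1 := (proj_closure R^o).
Local Notation T := (dr_s S * R^o)%type.

(** For v = 0, z = 0 and s^2 = 1, the lift [conic_lift] is ta - s th times this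
    map. *)
Definition line_lift (x : L) : T :=
  let th := x.1 : R in let ta := x.2 : R in ((0, 0, ta + s * th), ta - s * th).

Lemma line_lift_linear : form_map 1 line_lift.
Proof.
apply: (form_map_eq (G := fun x : L =>
  (s * x.1 + 1 * x.2) *: (((0, 0, 1), 0) : T) +
  (- s * x.1 + 1 * x.2) *: (((0, 0, 0), 1) : T))).
  move=> [th ta]; rewrite /line_lift /=.
  have -> (a b : R) (A B : T) : a *: A + b *: B =
    ((a *: A.1.1.1 + b *: B.1.1.1, a *: A.1.1.2 + b *: B.1.1.2,
      a * A.1.2 + b * B.1.2), a * A.2 + b * B.2) by [].
  by congr (_, _, _, _); rewrite /= ?scaler0 ?addr0 //; ring.
by apply: form_mapD; apply: form_mapZ; apply: form_scalar; exact: scalar_line.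
Qed.

Lemma line_lift_neq0 : s ^+ 2 = 1 -> forall x, x != 0 -> line_lift x != 0.
Proof.
move=> s1; have s0 : s != 0 by rewrite -sqrf_eq0 s1 oner_neq0.
move=> [th ta]; rewrite /line_lift /= => x0; apply: contraNneq x0 => -[e1 e2].
have ta0 : ta = 0.
  have : 2 * ta = (ta + s * th) + (ta - s * th) by ring.
  by rewrite e1 e2 addr0 => /eqP; rewrite mulf_eq0 pnatr_eq0 => /eqP.
by move/eqP: e1; rewrite ta0 add0r mulf_eq0 (negbTE s0) => /eqP ->.
Qed.

Lemma line_lift_curve : s ^+ 2 = 1 -> forall th,
  dr_chi ((0, 0, s) : dr_s S) th != 0 ->
  exists c, line_lift (th, 1) =
    c *: ((dr_curve ((0, 0, s) : dr_s S) th, 1) : T).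
Proof.
move=> s1 th; rewrite /dr_curve.
have -> : dr_chi ((0, 0, s) : dr_s S) th = (1 - s * th) ^+ 2.
  by rewrite /dr_chi /= linear0l mul0r addr0.
rewrite sqrf_eq0 => X0; exists (1 - s * th).
have -> (k d : R) (a : dr_v S) (b : dr_z S) :
  k *: ((a, b, d, 1) : T) = (k *: a, k *: b, k * d, k * 1) by [].
have -> : dr_J (0 : dr_z S) (0 : dr_v S) = 0 by exact: linear0.
rewrite /line_lift /= !(scaler0, addr0) mulr1; congr (_, _, _, _).
have -> : 1 - th ^+ 2 =
  (1 - s * th) * (1 + s * th) + (s ^+ 2 - 1) * th ^+ 2 by ring.
by rewrite s1; field.
Qed.

Lemma geodesic_line (m0 : proj_closure (dr_s S)) : s ^+ 2 = 1 ->
  exists2 C : set (dr_s S), is_line_parallel_to (dr_a S) C &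
    birational_onto [set: P1] (closure ((@affine_point R (dr_s S)) @` C))
      (proj_map m0 line_lift).
Proof.
move=> s1; set C := [set (0 : dr_s S) + x *: (dr_A S) | x in [set: R]].
exists C.
  exists 0, (dr_A S); split => //; last exact: memv_line.
  by rewrite !xpair_eqE oner_eq0 andbF.
have hG := line_lift_linear; have G0 := line_lift_neq0 s1.
have dN : dense (nonvanishing (fun x : L => (line_lift x).2)).
  have -> : nonvanishing (fun x : L => (line_lift x).2) =
      nonvanishing (fun x : L => (- s) * x.1 + 1 * x.2 : R).
    apply/seteqP; split => l h [th ta] xl x0; have := h _ xl x0;
    by rewrite /= mul1r mulNr addrC.
  by apply: dense_nonvanishing_line; right; rewrite oner_neq0.
have AE (x : R) : 0 + x *: dr_A S = (0, 0, x).
  rewrite add0r; congr (_, _, _); rewrite ?scaler0 //.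
  by rewrite -[LHS]/(_ * _) mulr1.
rewrite (proj_map_affine m0 hG (C := C)); last first.
- move=> _ [x _ <-]; rewrite AE.
  (* Solution of ta - s th = 1 and ta + s th = x, as 1 / s = s. *)
  pose th := s * (x - 1) / 2; pose ta := (x + 1) / 2.
  have e1 : ta - s * th = 1.
    have -> : ta - s * th = (x + 1) / 2 - s ^+ 2 * (x - 1) / 2.
      by rewrite /ta /th; ring.
    by rewrite s1; field.
  have e2 : ta + s * th = x.
    have -> : ta + s * th = (x + 1) / 2 + s ^+ 2 * (x - 1) / 2.
      by rewrite /ta /th; ring.
    by rewrite s1; field.
  exists (th, ta); rewrite /line_lift /= e1 e2 scale1r oner_neq0; split => //.
  apply/eqP => -[t0 t1]; move/eqP: e1.
  by rewrite t0 t1 mulr0 subr0 eq_sym oner_eq0.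
- move=> [th ta] x0; rewrite /line_lift /= => X0.
  exists ((ta - s * th)^-1 * (ta + s * th)) => //.
  rewrite AE; have -> (k d : R) (a : dr_v S) (b : dr_z S) :
    k *: ((a, b, d) : dr_s S) = (k *: a, k *: b, k * d) by [].
  by rewrite !scaler0.
rewrite closure_proj_image //; last exact: proj_map_continuous hG G0.
pose H (y : T) : L := (s * y.1.2 - s * y.2, (y.1.2 : R) + y.2).
apply: (@birational_of_linear_inverse _ _ _ 1 (affine_point (0 : R^o)) m0 _
  H (fun y => y.2)) => //.
- apply: (form_map_eq (G := fun y : T =>
    ((s * y.1.2 - s * y.2) : R) *: ((1, 0) : L) +
    ((y.1.2 : R) + y.2) *: ((0, 1) : L))).
    move=> y; rewrite /H; congr pair;
    by rewrite /= !scR ?mulr1 ?mulr0 ?addr0 ?add0r.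
  apply: form_mapD; apply: form_mapZ; apply: form_scalar => a x y;
  rewrite /= !scR;
  by move: x.2 y.2 x.1.2 y.1.2 => ? ? ? ?; ring.
- move=> [th ta] _; exists 2; first by rewrite pnatr_eq0.
  rewrite /H /line_lift /=; congr pair; rewrite /= scR; last by ring.
  have -> : s * (ta + s * th) - s * (ta - s * th) = 2 * (s ^+ 2 * th).
    by ring.
  by rewrite s1 mul1r.
Qed.

End Line.

(** * The three cases *)

Lemma dnorm1_sum (R : realType) (S : damek_ricci R) (v : dr_v S) (z : dr_z S)
    (s : R) : dnorm (dr_dot (S := S)) (v, z, s) = 1 ->
  dr_dotv S v v + dr_dotz S z z + s ^+ 2 = 1 :> R.
Proof.
rewrite /dnorm => h.
have h0 : 0 <= dr_dot (v, z, s) (v, z, s).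
  rewrite leNgt; apply/negP => /ltW/ler0_sqrtr e.
  by move/eqP: h; rewrite e eq_sym oner_eq0.
by rewrite -[RHS](expr1n _ 2) -h sqr_sqrtr.
Qed.

Theorem theorem5p1 (R : realType) (S : damek_ricci R) (v : dr_v S) (z : dr_z S)
    (s : R) (hxi : dnorm (dr_dot (S := S)) (v, z, s) = 1) :
  exists gamma : proj_closure R^o -> proj_closure (dr_s S),
    [/\ unique (is_prolongation (v, z, s)) gamma,
        z != 0 ->
          exists2 C : set (dr_s S), is_ellipse (dr_dot (S := S)) C &
            birational_onto [set: proj_closure R^o]
              ((@affine_point R (dr_s S)) @` C) gamma,
        z = 0 -> v != 0 ->
          exists2 C : set (dr_s S),
            is_parabola_with_axis_parallel_to (dr_dot (S := S)) (dr_a S) C &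
            birational_onto [set: proj_closure R^o]
              (closure ((@affine_point R (dr_s S)) @` C)) gamma &
        ((v, z, s) : dr_s S) \in dr_a S ->
          exists2 C : set (dr_s S), is_line_parallel_to (dr_a S) C &
            birational_onto [set: proj_closure R^o]
              (closure ((@affine_point R (dr_s S)) @` C)) gamma].
Proof.
have sum1 := dnorm1_sum hxi.
pose m0 := affine_point (0 : dr_s S).
have uniq gamma : is_prolongation (v, z, s) gamma ->
    unique (is_prolongation (v, z, s)) gamma.
  by move=> h; split => // g; exact: prolongation_unique.
have in_a : ((v, z, s) : dr_s S) \in dr_a S -> v = 0 /\ z = 0.
  by move=> /vlineP[k [-> -> _]]; rewrite !scaler0.
have [z0|z0] := eqVneq z 0; last first.
  exists (proj_map m0 (conic_lift v z s)); split => [|_|ez|/in_a[_ ez]].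
  - apply: uniq.
    apply: (is_prolongation_proj_map m0 (conic_lift_quadratic v z s)).
      by move=> x /(conic_lift_neq0_z v s z0); apply: contraNneq => ->.
    by move=> th c0; exists (dr_chi (v, z, s) th); exact: conic_lift_curve.
  - exact: geodesic_ellipse.
  - by rewrite ez eqxx in z0.
  - by rewrite ez eqxx in z0.
subst z; rewrite linear0l addr0 in sum1.
have [v0|v0] := eqVneq v 0; last first.
  have qs : dr_dotv S v v = 1 - s ^+ 2 by rewrite -sum1 addrK.
  exists (proj_map m0 (conic_lift v 0 s)); split => [|/eqP //|_ _|/in_a[ev _]].
  - apply: uniq.
    apply: (is_prolongation_proj_map m0 (conic_lift_quadratic v 0 s)).
      exact: conic_lift_neq0_v.
    by move=> th c0; exists (dr_chi (v, 0, s) th); exact: conic_lift_curve.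
  - exact: geodesic_parabola.
  - by rewrite ev eqxx in v0.
subst v; rewrite linear0l add0r in sum1.
exists (proj_map m0 (line_lift S s)); split => [|/eqP //|_ /eqP //|_].
- apply: uniq; apply: (is_prolongation_proj_map m0 (@line_lift_linear R S s)).
    exact: line_lift_neq0.
  exact: line_lift_curve.
- exact: geodesic_line.
Qed.
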